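(* Let $\Sigma$ be a finite alphabet and let $\Gamma$ consist of $T_1[s]$ together with all instances $\mathrm{Ind}[Z,P,s]$ of the induction principle for first-order formulas $Z,P$ over $vocab(\Sigma)$. Then $\Gamma$ is TC complete with respect to $A_{\Sigma w}$: for every first-order sentence $\psi$ over $vocab(\Sigma)$ that is true in every TC model of $A_{\Sigma w}$ (equivalently, in every word model over $\Sigma$), $\Gamma\cup\{A_{\Sigma w}\}\vdash\psi$.
   Context: $vocab(\Sigma)$ consists of constants $0,max$, binary relation symbols $s$ and $s^*$, and unary relation symbols $P_\sigma$ for $\sigma\in\Sigma$. A TC model is a structure interpreting $s^*$ as the reflexive transitive closure of $s$. $A_{\Sigma w}$ is the conjunction of: (A1) $\forall x\,.\,(\lnot s(x,0)\land\lnot s(max,x)\land(x\neq0\rightarrow\exists y\,.\,s(y,x))\land(x\neq max\rightarrow\exists y\,.\,s(x,y)))$; (A2) $\forall x,y,z\,.\,((s(x,y)\land s(x,z))\lor(s(y,x)\land s(z,x)))\rightarrow y=z$; (A3) $\forall x\,.\,s^*(0,x)\land s^*(x,max)$; (A4) $\forall x\,.\,\bigvee_{\sigma\in\Sigma}(P_\sigma(x)\land\bigwedge_{\tau\neq\sigma}\lnot P_\tau(x))$. A word model of a nonempty word $\sigma_0\cdots\sigma_{n-1}$ has universe $\{0,\dots,n-1\}$, $0\mapsto 0$, $max\mapsto n-1$, $s=\{(i,i+1)\}$, $s^*=\le$, $P_\sigma=\{i:\sigma_i=\sigma\}$. $T_1[s]\equiv\forall u,v\,.\,s^*(u,v)\leftrightarrow((u=v)\lor\exists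 w\,.\,s(u,w)\land s^*(w,v))$. $\mathrm{Ind}[Z,P,s]\equiv[(\forall w\,.\,Z(w)\rightarrow P(w))\land(\forall u,v\,.\,P(u)\land s(u,v)\rightarrow P(v))]\rightarrow\forall u,w\,.\,Z(w)\land s^*(w,u)\rightarrow P(u)$, where $Z(u),P(u)$ may contain further free variables over which the instance is universally closed. *)

(* Defs.v *)
From Stdlib Require List.
From Stdlib Require Import Relation_Operators.
From mathcomp Require Import all_boot.
Set Implicit Arguments.
Unset Strict Implicit.
Unset Printing Implicit Defensive.

(* Terms and formulas use de Bruijn indices: [Var i] refers to the i-th
   enclosing quantifier, counted from the innermost one, and then to the free
   variables.  [Succ] is the symbol s and [Path] is the symbol s^*. *)
Inductive term : Type := Var of nat | Zero | Max.

Inductive form (Sigma : finType) : Type :=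
| Bot
| Eq of term & term
| Succ of term & term
| Path of term & term
| Letter of Sigma & term
| Imp of form Sigma & form Sigma
| All of form Sigma.
Arguments Bot {Sigma}.
Arguments Eq {Sigma}.
Arguments Succ {Sigma}.
Arguments Path {Sigma}.

Declare Scope fo_scope.
Delimit Scope fo_scope with fo.
Bind Scope fo_scope with form.

Definition Neg (Sigma : finType) (A : form Sigma) := Imp A Bot.
Definition Top (Sigma : finType) : form Sigma := Neg Bot.
Definition And (Sigma : finType) (A B : form Sigma) := Neg (Imp A (Neg B)).
Definition Or (Sigma : finType) (A B : form Sigma) := Imp (Neg A) B.
Definition Iff (Sigma : finType) (A B : form Sigma) := And (Imp A B) (Imp B A).
Definition Ex (Sigma : finType) (A : form Sigma) := Neg (All (Neg A)).
Arguments Top {Sigma}.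

Notation "# i" := (Var i) (at level 1, format "# i") : fo_scope.
Notation "t ≈ u" := (Eq t%fo u%fo) (at level 70) : fo_scope.
Notation "t ≉ u" := (Neg (Eq t%fo u%fo)) (at level 70) : fo_scope.
Notation "'¬' A" := (Neg A) (at level 75, right associativity) : fo_scope.
Notation "A ∧ B" := (And A B) (at level 80, right associativity) : fo_scope.
Notation "A ∨ B" := (Or A B) (at level 85, right associativity) : fo_scope.
Notation "A → B" := (Imp A B)
  (at level 99, B at level 200, right associativity) : fo_scope.
Notation "A ↔ B" := (Iff A B) (at level 95, no associativity) : fo_scope.
Notation "'∀' A" := (All A) (at level 200, right associativity) : fo_scope.
Notation "'∃' A" := (Ex A) (at level 200, right associativity) : fo_scope.

Definition scons (X : Type) (x : X) (f : nat -> X) (i : nat) : X :=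
  if i is j.+1 then f j else x.

Definition tsubst (f : nat -> term) (t : term) : term :=
  if t is Var i then f i else t.

Definition tshift : term -> term := tsubst (fun i => Var i.+1).

Fixpoint subst (Sigma : finType) (f : nat -> term) (A : form Sigma) :
    form Sigma :=
  match A with
  | Bot => Bot
  | Eq t u => Eq (tsubst f t) (tsubst f u)
  | Succ t u => Succ (tsubst f t) (tsubst f u)
  | Path t u => Path (tsubst f t) (tsubst f u)
  | Letter a t => Letter a (tsubst f t)
  | Imp B C => Imp (subst f B) (subst f C)
  | All B => All (subst (scons (Var 0) (fun i => tshift (f i))) B)
  end.

Definition shift (Sigma : finType) : form Sigma -> form Sigma :=
  subst (fun i => Var i.+1).

Definition inst (Sigma : finType) (t : term) : form Sigma -> form Sigma :=
  subst (scons t Var).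

(* The least n such that all free variables have index < n. *)
Definition tbound (t : term) : nat := if t is Var i then i.+1 else 0.

Fixpoint fbound (Sigma : finType) (A : form Sigma) : nat :=
  match A with
  | Bot => 0
  | Eq t u | Succ t u | Path t u => maxn (tbound t) (tbound u)
  | Letter _ t => tbound t
  | Imp B C => maxn (fbound B) (fbound C)
  | All B => (fbound B).-1
  end.

Definition sentence (Sigma : finType) (A : form Sigma) : Prop := fbound A = 0.

Definition closure (Sigma : finType) (A : form Sigma) : form Sigma :=
  iter (fbound A) (@All Sigma) A.

Record structure (Sigma : finType) : Type := Structure {
  dom :> Type;
  zero_of : dom;
  max_of : dom;
  succ_of : dom -> dom -> Prop;
  path_of : dom -> dom -> Prop;
  letter_of : Sigma -> dom -> Prop }.

Definition teval (Sigma : finType) (M : structure Sigma) (rho : nat -> M)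
    (t : term) : M :=
  match t with Var i => rho i | Zero => zero_of M | Max => max_of M end.

Fixpoint sat (Sigma : finType) (M : structure Sigma) (rho : nat -> M)
    (A : form Sigma) : Prop :=
  match A with
  | Bot => False
  | Eq t u => teval rho t = teval rho u
  | Succ t u => succ_of (teval rho t) (teval rho u)
  | Path t u => path_of (teval rho t) (teval rho u)
  | Letter a t => letter_of a (teval rho t)
  | Imp B C => sat rho B -> sat rho C
  | All B => forall x : M, sat (scons x rho) B
  end.

Definition models (Sigma : finType) (M : structure Sigma) (A : form Sigma) :
    Prop :=
  forall rho : nat -> M, sat rho A.

Definition TC_model (Sigma : finType) (M : structure Sigma) : Prop :=
  forall x y : M, path_of x y <-> clos_refl_trans M (@succ_of Sigma M) x y.

(* Nonempty words are the tuples of length n.+1. *)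
Definition word_model (Sigma : finType) (n : nat) (w : n.+1.-tuple Sigma) :
    structure Sigma :=
  {| dom := 'I_n.+1;
     zero_of := ord0;
     max_of := ord_max;
     succ_of := fun i j => j = i.+1 :> nat;
     path_of := fun i j => i <= j;
     letter_of := fun a i => tnth w i = a |}.

Inductive deriv (Sigma : finType) : seq (form Sigma) -> form Sigma -> Prop :=
| deriv_hyp G A : List.In A G -> deriv G A
| deriv_impI G A B : deriv (A :: G) B -> deriv G (Imp A B)
| deriv_impE G A B : deriv G (Imp A B) -> deriv G A -> deriv G B
| deriv_raa G A : deriv (Neg A :: G) Bot -> deriv G A
| deriv_allI G A : deriv (map (@shift Sigma) G) A -> deriv G (All A)
| deriv_allE G A t : deriv G (All A) -> deriv G (inst t A)
| deriv_eqI G t : deriv G (Eq t t)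
| deriv_eqE G A t u :
    deriv G (Eq t u) -> deriv G (inst t A) -> deriv G (inst u A).

Definition theory (Sigma : finType) : Type := form Sigma -> Prop.

Definition provable (Sigma : finType) (T : theory Sigma) (A : form Sigma) :
    Prop :=
  exists2 G : seq (form Sigma), (forall B, List.In B G -> T B) & deriv G A.

Definition TC_valid (Sigma : finType) (A psi : form Sigma) : Prop :=
  forall M : structure Sigma, TC_model M -> models M A -> models M psi.

Definition TC_complete (Sigma : finType) (T : theory Sigma) (A : form Sigma) :
    Prop :=
  forall psi : form Sigma, sentence psi -> TC_valid A psi ->
    provable (fun B => T B \/ B = A) psi.

Local Open Scope fo_scope.

Section WordAx.
Variable Sigma : finType.
Implicit Types Z P : form Sigma.

Definition A1 : form Sigma :=
  ∀ ¬ Succ #0 Zero ∧ ¬ Succ Max #0 ∧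
    (#0 ≉ Zero → ∃ Succ #0 #1) ∧ (#0 ≉ Max → ∃ Succ #1 #0).

Definition A2 : form Sigma :=
  ∀ ∀ ∀ (Succ #2 #1 ∧ Succ #2 #0) ∨ (Succ #1 #2 ∧ Succ #0 #2) → #1 ≈ #0.

Definition A3 : form Sigma := ∀ Path Zero #0 ∧ Path #0 Max.

Definition A4 : form Sigma :=
  ∀ \big[@Or Sigma/Bot]_(a : Sigma)
      (Letter a #0 ∧
       \big[@And Sigma/Top]_(b : Sigma | b != a) (¬ Letter b #0)).

Definition A_word : form Sigma := A1 ∧ A2 ∧ A3 ∧ A4.

Definition T1 : form Sigma :=
  ∀ ∀ Path #1 #0 ↔ (#1 ≈ #0 ∨ ∃ Succ #2 #0 ∧ Path #0 #1).

(* In Z and P the distinguished variable has index 0 and the i-th further free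
   variable has index i.+1.  Under two quantifiers, [app2 P t] is P(t): there
   the i-th further free variable has index i.+2. *)
Definition app2 P (t : term) : form Sigma :=
  subst (scons t (fun i => Var i.+2)) P.

Definition Ind Z P : form Sigma :=
  ((∀ Z → P) ∧ (∀ ∀ app2 P #1 ∧ Succ #1 #0 → app2 P #0)) →
  ∀ ∀ app2 Z #0 ∧ Path #0 #1 → app2 P #1.

Definition T1_Ind : theory Sigma :=
  fun B => B = T1 \/ exists Z P, B = closure (Ind Z P).

End WordAx.

Arguments T1_Ind : clear implicits.

(* Main.v *)
Require Import Defs.
From mathcomp Require Import all_boot.
From HB Require Import structures.
From Stdlib Require Import Relation_Operators Operators_Properties.
From mathcomp Require Import boolp zify.
Set Implicit Arguments.
Unset Strict Implicit.
Unset Printing Implicit Defensive.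

(* Let M satisfy A_word, T1 and Ind.  For fixed k, "the initial segment [0, u]
   of M has the same rank-k type as some word" is a first-order property of u,
   because there are finitely many rank-k types and each is defined by a
   formula relativized to [0, u].  It holds at 0 and passes from u to its
   successor u': the rank-k type of [0, u'] depends only on that of [0, u] and
   on the letter of u' (Ehrenfeucht-Fraisse composition).  By Ind it holds at
   max, so M and some word agree on all sentences of rank k.  A TC model
   satisfies T1 and Ind, so truth in TC models of A_word is truth in words;
   derivability follows by Henkin's completeness theorem. *)

(** * Encoding and satisfaction *)

(** Formulas are encoded for two purposes: membership in lists of formulas needs decidable equality,
    and the Henkin construction enumerates all formulas through [unpickle]. *)
Definition term_code (t : term) : nat + bool :=
  match t with Var i => inl i | Zero => inr true | Max => inr false end.

Definition term_decode (c : nat + bool) : term :=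
  match c with inl i => Var i | inr true => Zero | inr false => Max end.

Lemma term_codeK : cancel term_code term_decode.
Proof. by case. Qed.

HB.instance Definition _ := Countable.copy term (can_type term_codeK).

Fixpoint form_code (Sigma : finType) (A : form Sigma) :
    GenTree.tree (term + Sigma) :=
  match A with
  | Bot => GenTree.Node 0 [::]
  | Eq t u => GenTree.Node 1 [:: GenTree.Leaf (inl t); GenTree.Leaf (inl u)]
  | Succ t u => GenTree.Node 2 [:: GenTree.Leaf (inl t); GenTree.Leaf (inl u)]
  | Path t u => GenTree.Node 3 [:: GenTree.Leaf (inl t); GenTree.Leaf (inl u)]
  | Letter a t => GenTree.Node 4 [:: GenTree.Leaf (inr a); GenTree.Leaf (inl t)]
  | Imp B C => GenTree.Node 5 [:: form_code B; form_code C]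
  | All B => GenTree.Node 6 [:: form_code B]
  end.

Fixpoint form_decode (Sigma : finType) (c : GenTree.tree (term + Sigma)) :
    option (form Sigma) :=
  match c with
  | GenTree.Node 0 [::] => Some Bot
  | GenTree.Node 1 [:: GenTree.Leaf (inl t); GenTree.Leaf (inl u)] =>
      Some (Eq t u)
  | GenTree.Node 2 [:: GenTree.Leaf (inl t); GenTree.Leaf (inl u)] =>
      Some (Succ t u)
  | GenTree.Node 3 [:: GenTree.Leaf (inl t); GenTree.Leaf (inl u)] =>
      Some (Path t u)
  | GenTree.Node 4 [:: GenTree.Leaf (inr a); GenTree.Leaf (inl t)] =>
      Some (Letter a t)
  | GenTree.Node 5 [:: b; c] =>
      if (form_decode b, form_decode c) is (Some B, Some C) then
        Some (Imp B C) else None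
  | GenTree.Node 6 [:: b] => omap (@All Sigma) (form_decode b)
  | _ => None
  end.

Lemma form_codeK (Sigma : finType) :
  pcancel (@form_code Sigma) (@form_decode Sigma).
Proof. by elim=> //= [B -> C -> | B ->]. Qed.

HB.instance Definition _ (Sigma : finType) :=
  Countable.copy (form Sigma) (pcan_type (@form_codeK Sigma)).

Section Satisfaction.
Variable Sigma : finType.
Implicit Types (M N : structure Sigma) (A B : form Sigma).

Lemma scons_comp (X Y : Type) (g : X -> Y) x (f : nat -> X) :
  (fun i => g (scons x f i)) = scons (g x) (fun i => g (f i)).
Proof. by apply: funext => -[]. Qed.

Lemma scons_eta (X : Type) (f : nat -> X) :
  scons (f 0) (fun i => f i.+1) = f.
Proof. by apply: funext => -[]. Qed.

Lemma teval_tsubst M (rho : nat -> M) f t :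
  teval rho (tsubst f t) = teval (fun i => teval rho (f i)) t.
Proof. by case: t. Qed.

Lemma sat_subst M A : forall (rho : nat -> M) f,
  sat rho (subst f A) <-> sat (fun i => teval rho (f i)) A.
Proof.
elim: A => /= [|t u|t u|t u|a t|B IB C IC|B IB] rho f //;
  rewrite ?teval_tsubst // ?IB ?IC //.
suff E x :
  (fun i => teval (scons x rho) (scons #0%fo (fun j => tshift (f j)) i)) =
    scons x (fun i => teval rho (f i)).
  by split=> H x; move/(_ x): H; rewrite IB E.
by rewrite scons_comp /=; congr scons; apply: funext => i; rewrite teval_tsubst.
Qed.

Lemma sat_bound M A : forall rho rho' : nat -> M,
  (forall i, i < fbound A -> rho i = rho' i) -> sat rho A <-> sat rho' A.
Proof.
have E t (rho rho' : nat -> M) : (forall i, i < tbound t -> rho i = rho' i) ->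
    teval rho t = teval rho' t.
  by case: t => //= i; apply.
elim: A => /= [|t u|t u|t u|a t|B IB C IC|B IB] rho rho' Er //.
1-3: by rewrite !(E _ rho rho') // => i Hi; apply: Er; rewrite leq_max Hi ?orbT.
- by rewrite !(E _ rho rho').
- by rewrite (IB _ rho') 1?(IC _ rho') // => i Hi; apply: Er;
    rewrite leq_max Hi ?orbT.
- suff H x : sat (scons x rho) B <-> sat (scons x rho') B.
    by split=> K x; move/(_ x): K; rewrite H.
  apply: IB => -[|i] //= Hi; apply: Er; lia.
Qed.

Lemma sat_And M (rho : nat -> M) A B :
  sat rho (And A B) <-> sat rho A /\ sat rho B.
Proof.
rewrite /=; split; last by case=> HA HB; apply.
by move=> H; split; apply: contrapT => K; apply: H.
Qed.

Lemma sat_Or M (rho : nat -> M) A B :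
  sat rho (Or A B) <-> sat rho A \/ sat rho B.
Proof.
rewrite /=; split=> [H|[HA nA|HB _] //].
by have [HA|HA] := pselect (sat rho A); auto.
Qed.

Lemma sat_Iff M (rho : nat -> M) A B :
  sat rho (Iff A B) <-> (sat rho A <-> sat rho B).
Proof. by rewrite sat_And. Qed.

Lemma sat_All M (rho : nat -> M) A :
  sat rho (All A) <-> forall x, sat (scons x rho) A.
Proof. by []. Qed.

Lemma sat_Imp M (rho : nat -> M) A B :
  sat rho (Imp A B) <-> (sat rho A -> sat rho B).
Proof. by []. Qed.

Lemma sat_Ex M (rho : nat -> M) A :
  sat rho (Ex A) <-> exists x, sat (scons x rho) A.
Proof.
rewrite /=; split=> [H|[x Hx] H]; last exact: H Hx.
by apply: contrapT => K; apply: H => x Hx; apply: K; exists x.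
Qed.

Lemma sat_bigOr M (rho : nat -> M) (I : eqType) (r : seq I) (P : pred I) F :
  sat rho (\big[@Or Sigma/Bot]_(i <- r | P i) F i) <->
  exists i, [/\ i \in r, P i & sat rho (F i)].
Proof.
elim: r => [|j r IH]; first by rewrite big_nil; split=> // -[i []].
rewrite big_cons; have [Pj|Pj] := boolP (P j).
- rewrite sat_Or IH; split=> [[H|[i [ri Pi H]]]|[i []]].
  + by exists j; rewrite mem_head.
  + by exists i; rewrite in_cons ri orbT.
  + rewrite in_cons => /orP[/eqP->|ri] Pi H; first by left.
    by right; exists i.
- rewrite IH; split=> -[i [ri Pi H]]; exists i; split=> //.
    by rewrite in_cons ri orbT.
  by move: ri; rewrite in_cons => /orP[/eqP E|//]; rewrite -E Pi in Pj.
Qed.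

Lemma sat_bigAnd M (rho : nat -> M) (I : eqType) (r : seq I) (P : pred I) F :
  sat rho (\big[@And Sigma/Top]_(i <- r | P i) F i) <->
  forall i, i \in r -> P i -> sat rho (F i).
Proof.
elim: r => [|j r IH]; first by rewrite big_nil; split=> //= _ i.
rewrite big_cons; have [Pj|Pj] := boolP (P j).
- rewrite sat_And IH; split=> [[H K] i|H].
  + by rewrite in_cons => /orP[/eqP->|ri] // Pi; apply: K.
  + split; first by apply: H => //; rewrite mem_head.
    by move=> i ri; apply: H; rewrite in_cons ri orbT.
- rewrite IH; split=> H i ri Pi; last first.
    by apply: H => //; rewrite in_cons ri orbT.
  move: ri; rewrite in_cons => /orP[/eqP E|ri]; last exact: H.
  by rewrite -E Pi in Pj.
Qed.

Lemma models_All M A : models M (All A) <-> models M A.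
Proof.
split=> H rho; last by move=> x; apply: H.
by have /= := H (fun i => rho i.+1) (rho 0); rewrite scons_eta.
Qed.

Lemma models_closure M A : models M (Defs.closure A) <-> models M A.
Proof.
by rewrite /Defs.closure; elim: (fbound A) => //= n IH; rewrite models_All.
Qed.

Lemma sentence_closure A : sentence (Defs.closure A).
Proof.
rewrite /sentence /Defs.closure.
suff E n B : fbound (iter n (@All Sigma) B) = fbound B - n.
  by rewrite E subnn.
by elim: n => [|n /= ->] /=; lia.
Qed.

Lemma models_sentence M (rho : nat -> M) A :
  sentence A -> sat rho A -> models M A.
Proof.
move=> A0 H rho'; apply: (proj1 (sat_bound _) H) => i; rewrite A0.
by [].
Qed.

Lemma sat_app2 M (rho : nat -> M) u v A t :
  sat (scons v (scons u rho)) (app2 A t) <->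
  sat (scons (teval (scons v (scons u rho)) t) rho) A.
Proof. by rewrite sat_subst scons_comp. Qed.

Lemma models_Ind M Z P : models M (Ind Z P) <->
  forall rho : nat -> M,
    (forall w, sat (scons w rho) Z -> sat (scons w rho) P) ->
    (forall u v, sat (scons u rho) P -> succ_of u v -> sat (scons v rho) P) ->
    forall u w, sat (scons w rho) Z -> path_of w u -> sat (scons u rho) P.
Proof.
split=> [H rho HZ HP u w Zw Pwu|H rho].
- move/(_ rho): H => /= H.
  have := H _ u w; rewrite !sat_app2 /=; apply; last by move=> K; apply: K.
  apply; first exact: HZ.
  move=> x y; rewrite !sat_app2 => K; apply: contrapT => K'; apply: K => Kx Ks.
  exact: K' (HP _ _ Kx Ks).
(* Conjunctions unfold to negated implications; they are folded back so that [sat_And] applies. *)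
- change (sat rho (And (All (Imp Z P)) (All (All
      (Imp (And (app2 P #1) (Succ #1 #0)) (app2 P #0)))))%fo ->
    forall u w, sat (scons w (scons u rho)) (And (app2 Z #0) (Path #0 #1))%fo ->
      sat (scons w (scons u rho)) (app2 P #1)%fo).
  rewrite sat_And => -[HZ HP] u w; rewrite sat_And !sat_app2 => -[Zw Pwu].
  apply: H Zw Pwu => // x y Px sxy.
  have : sat (scons y (scons x rho)) (And (app2 P #1) (Succ #1 #0))%fo ->
    sat (scons y (scons x rho)) (app2 P #0)%fo := HP x y.
  by rewrite sat_And !sat_app2; apply.
Qed.

Lemma models_T1 M : models M (T1 Sigma) <->
  forall u v : M, path_of u v <->
    u = v \/ exists2 w, succ_of u w & path_of w v.
Proof.
have E (rho : nat -> M) u v : sat (scons v (scons u rho))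
     (Iff (Path #1 #0)
       (Or (Eq #1 #0) (Ex (And (Succ #2 #0) (Path #0 #1)))))%fo <->
   (path_of u v <-> u = v \/ exists2 w, succ_of u w & path_of w v).
  rewrite sat_Iff sat_Or sat_Ex /=.
  suff -> : (exists x, sat (scons x (scons v (scons u rho)))
      (And (Succ #2 #0) (Path #0 #1))%fo) <->
      exists2 w, succ_of u w & path_of w v by [].
  by split=> -[w]; [move/sat_And => [] | move=> *]; exists w => //;
    apply/sat_And.
split=> H; last by move=> rho u v; apply/E.
by move=> u v; apply/(E (fun _ => u)); apply: H.
Qed.

Record word_axioms M : Prop := WordAxioms {
  succ_zeroN : forall x : M, ~ succ_of x (zero_of M);
  succ_maxN : forall x : M, ~ succ_of (max_of M) x;
  pred_ex : forall x : M, x <> zero_of M -> exists y, succ_of y x;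
  succ_ex : forall x : M, x <> max_of M -> exists y, succ_of x y;
  succ_fun : forall x y z : M, succ_of x y -> succ_of x z -> y = z;
  succ_inj : forall x y z : M, succ_of y x -> succ_of z x -> y = z;
  path_zero : forall x : M, path_of (zero_of M) x;
  path_max : forall x : M, path_of x (max_of M);
  letter_ex : forall x : M, exists a,
    forall b, letter_of b x <-> b = a }.

Lemma models_A_word M (x0 : M) :
  models M (A_word Sigma) <-> word_axioms M.
Proof.
split=> [H|H rho].
- have /sat_And[H1 /sat_And[H2 /sat_And[H3 H4]]] := H (fun _ => x0).
  have {}H1 := proj1 (sat_All _ _) H1; have {}H3 := proj1 (sat_All _ _) H3.
  have {}H4 := proj1 (sat_All _ _) H4.
  have {}H2 x y z := proj1 (sat_Imp _ _ _) (proj1 (sat_All _ _)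
    (proj1 (sat_All _ _) (proj1 (sat_All _ _) H2 x) y) z).
  split.
  + by move=> x; have /sat_And[K _] := H1 x.
  + by move=> x; have /sat_And[_ /sat_And[K _]] := H1 x.
  + move=> x Hx; have /sat_And[_ /sat_And[_ /sat_And[K _]]] := H1 x.
    exact: (proj1 (sat_Ex _ _) (proj1 (sat_Imp _ _ _) K Hx)).
  + move=> x Hx; have /sat_And[_ /sat_And[_ /sat_And[_ K]]] := H1 x.
    exact: (proj1 (sat_Ex _ _) (proj1 (sat_Imp _ _ _) K Hx)).
  + move=> x y z Hy Hz; apply: (H2 x y z); apply/sat_Or; left.
    exact/sat_And.
  + move=> x y z Hy Hz; apply: (H2 x y z); apply/sat_Or; right.
    exact/sat_And.
  + by move=> x; have /sat_And[] := H3 x.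
  + by move=> x; have /sat_And[] := H3 x.
  + move=> x; have /sat_bigOr[a [_ _ /sat_And[La /sat_bigAnd K]]] := H4 x.
    exists a => b; split=> [Lb|->//]; apply/eqP; apply: contrapT => /negP ba.
    by have /= := K b (mem_index_enum _) ba; apply.
- apply/sat_And; split.
    apply/sat_All => x; apply/sat_And; split; first exact: succ_zeroN.
    apply/sat_And; split; first exact: succ_maxN.
    apply/sat_And; split; apply/sat_Imp; [move/(pred_ex H)|move/(succ_ex H)];
      by move=> ?; apply/sat_Ex.
  apply/sat_And; split.
    apply/sat_All => x; apply/sat_All => y; apply/sat_All => z.
    apply/sat_Imp => /sat_Or[] /sat_And[]; [exact: succ_fun|exact: succ_inj].
  apply/sat_And; split.
    apply/sat_All => x; apply/sat_And.
    by split; [exact: path_zero|exact: path_max].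
  apply/sat_All => x; have [a La] := letter_ex H x.
  apply/sat_bigOr; exists a; split=> //.
  apply/sat_And; split; first exact/La.
  by apply/sat_bigAnd => b _ ba /= /La /eqP; apply/negP.
Qed.

End Satisfaction.

(** * Types of initial segments *)

Section Relativization.
Variable Sigma : finType.
Implicit Types (M N : structure Sigma) (A B C : form Sigma).

(** Together with [rsat] this gives truth in the initial segment up to [u], whose maximum is [u],
    without building a structure on a subtype. *)
Definition reval M (u : M) (rho : nat -> M) (t : term) : M :=
  match t with Var i => rho i | Zero => zero_of M | Max => u end.

Fixpoint rsat M (u : M) (rho : nat -> M) A : Prop :=
  match A with
  | Bot => False
  | Eq t t' => reval u rho t = reval u rho t'
  | Succ t t' => succ_of (reval u rho t) (reval u rho t')
  | Path t t' => path_of (reval u rho t) (reval u rho t')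
  | Letter a t => letter_of a (reval u rho t)
  | Imp B C => rsat u rho B -> rsat u rho C
  | All B => forall x : M, path_of x u -> rsat u (scons x rho) B
  end.

Lemma rsat_And M (u : M) rho A B :
  rsat u rho (And A B) <-> rsat u rho A /\ rsat u rho B.
Proof.
rewrite /=; split; last by case=> HA HB; apply.
by move=> H; split; apply: contrapT => K; apply: H.
Qed.

Lemma rsat_Ex M (u : M) rho A :
  rsat u rho (Ex A) <-> exists2 x, path_of x u & rsat u (scons x rho) A.
Proof.
rewrite /=; split=> [H|[x Px Hx] H]; last exact: H Hx.
by apply: contrapT => K; apply: H => x Px Hx; apply: K; exists x.
Qed.

(** The variable of index [d] holds the endpoint of the segment; [relativize] raises [d] by one
    under each quantifier. *)
Definition trel (d : nat) (t : term) : term := if t is Max then Var d else t.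

Fixpoint relativize (d : nat) A : form Sigma :=
  match A with
  | Bot => Bot
  | Eq t u => Eq (trel d t) (trel d u)
  | Succ t u => Succ (trel d t) (trel d u)
  | Path t u => Path (trel d t) (trel d u)
  | Letter a t => Letter a (trel d t)
  | Imp B C => Imp (relativize d B) (relativize d C)
  | All B => All (Imp (Path (Var 0) (Var d.+1)) (relativize d.+1 B))
  end.

Lemma sat_relativize M A : forall d (rho : nat -> M),
  sat rho (relativize d A) <-> rsat (rho d) rho A.
Proof.
have E d (rho : nat -> M) t : teval rho (trel d t) = reval (rho d) rho t.
  by case: t.
elim: A => /= [|t u|t u|t u|a t|B IB C IC|B IB] d rho; rewrite ?E ?IB ?IC //.
by split=> H x Px; move/(_ x Px): H; rewrite IB.
Qed.

Lemma rsat_top M (u : M) A : (forall x : M, path_of x u) -> u = max_of M ->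
  forall rho, rsat u rho A <-> sat rho A.
Proof.
move=> top umax.
have E (rho : nat -> M) t : reval u rho t = teval rho t by case: t.
elim: A => /= [|t t'|t t'|t t'|a t|B IB C IC|B IB] rho; rewrite ?E ?IB ?IC //.
by split=> [H x|H x _]; [have := H x (top x)|have := H x]; rewrite IB.
Qed.

(** On the two segments [h] is total in both directions and respects equality, so it is an
    isomorphism between them. A relation spares the construction of maps: the uses take equality of
    positions in two words, or a relation on one-point segments. *)
Lemma rsat_iso M N (u : M) (v : N) (h : M -> N -> Prop) A :
  h (zero_of M) (zero_of N) -> h u v ->
  (forall x, path_of x u -> exists2 y, path_of y v & h x y) ->
  (forall y, path_of y v -> exists2 x, path_of x u & h x y) ->
  (forall x y x' y', h x y -> h x' y' ->
     [/\ x = x' <-> y = y', succ_of x x' <-> succ_of y y',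
         path_of x x' <-> path_of y y' &
         forall a, letter_of a x <-> letter_of a y]) ->
  forall rho sigma, (forall i, h (rho i) (sigma i)) ->
    rsat u rho A <-> rsat v sigma A.
Proof.
move=> h0 huv fw bw ha.
have E (rho : nat -> M) (sigma : nat -> N) t :
    (forall i, h (rho i) (sigma i)) -> h (reval u rho t) (reval v sigma t).
  by move=> K; case: t => /=.
elim: A => /= [|t t'|t t'|t t'|a t|B IB C IC|B IB] rho sigma hrs //.
1-3: by have [] := ha _ _ _ _ (E _ _ t hrs) (E _ _ t' hrs).
- by have [_ _ _] := ha _ _ _ _ (E _ _ t hrs) (E _ _ t hrs); apply.
- by rewrite (IB _ _ hrs) (IC _ _ hrs).
- split=> [H y Py|H x Px].
  + have [x Px hxy] := bw _ Py; apply: (iffLR (IB _ _ _) (H x Px)).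
    by case.
  + have [y Py hxy] := fw _ Px; apply: (iffRL (IB _ _ _) (H y Py)).
    by case.
Qed.

(** * Ehrenfeucht-Fraisse games and the finiteness of rank-k types *)

Fixpoint qrank A : nat :=
  match A with
  | Imp B C => maxn (qrank B) (qrank C)
  | All B => (qrank B).+1
  | _ => 0
  end.

Definition atomic A : bool := if A is (Imp _ _ | All _) then false else true.

(** The duplicator wins the Ehrenfeucht-Fraisse game with [k] rounds left on the two segments, the
    first [n] variables being the pebbles already placed. Atomic formulas also compare the pebbles
    with the constants. *)
Fixpoint bf k n M N (u : M) (v : N) (rho : nat -> M) (sigma : nat -> N) :
    Prop :=
  (forall A, atomic A -> fbound A <= n -> (rsat u rho A <-> rsat v sigma A)) /\
  (if k is k'.+1 then
     (forall x, path_of x u -> exists2 y, path_of y v &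
        bf k' n.+1 u v (scons x rho) (scons y sigma)) /\
     (forall y, path_of y v -> exists2 x, path_of x u &
        bf k' n.+1 u v (scons x rho) (scons y sigma))
   else True).

Lemma bf_atomic k n M N (u : M) (v : N) rho sigma A :
  bf k n u v rho sigma -> atomic A -> fbound A <= n ->
  rsat u rho A <-> rsat v sigma A.
Proof. by case: k => [|k] [H _]; apply: H. Qed.

(** The easy half of the Ehrenfeucht-Fraisse theorem: each quantifier uses up one round and places
    one more pebble. *)
Lemma bf_rsat M N (u : M) (v : N) A : forall k n rho sigma,
  bf k n u v rho sigma -> qrank A <= k -> fbound A <= n ->
  rsat u rho A <-> rsat v sigma A.
Proof.
elim: A => [|t t'|t t'|t t'|a t|B IB C IC|B IB] k n rho sigma H.
1-5: by move=> _; apply: bf_atomic H _.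
- rewrite /= !geq_max => /andP[Bk Ck] /andP[Bn Cn].
  by rewrite (IB k n rho sigma) // (IC k n rho sigma).
- case: k H => [|k] //= [_ [fw bw]] Bk Bn.
  have {}Bn : fbound B <= n.+1 by lia.
  split=> K x Px.
  + by have [y Py H] := bw x Px; apply: (iffLR (IB _ _ _ _ H Bk Bn)); apply: K.
  + by have [y Py H] := fw x Px; apply: (iffRL (IB _ _ _ _ H Bk Bn)); apply: K.
Qed.

(** These are the complete descriptions over [s], one for each choice of signs: every valuation
    satisfies one of them, and two valuations that share one agree on all of [s]. *)
Fixpoint sign_conjs (s : seq (form Sigma)) : seq (form Sigma) :=
  if s is A :: s' then
    map (And A) (sign_conjs s') ++ map (And (Neg A)) (sign_conjs s')
  else [:: Top].

Lemma sign_conjs_ex M (u : M) rho s :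
  exists2 C, C \in sign_conjs s & rsat u rho C.
Proof.
elim: s => [|A s [C Cs HC]] /=; first by exists Top.
have [HA|HA] := pselect (rsat u rho A).
- by exists (And A C); [rewrite mem_cat map_f|apply/rsat_And].
- by exists (And (Neg A) C); [rewrite mem_cat map_f ?orbT|apply/rsat_And].
Qed.

Lemma sign_conjs_agree M N (u : M) (v : N) rho sigma s C :
  C \in sign_conjs s -> rsat u rho C -> rsat v sigma C ->
  forall A, A \in s -> rsat u rho A <-> rsat v sigma A.
Proof.
elim: s C => [|B s IH] C //=; rewrite mem_cat => /orP[] /mapP[D Ds ->].
all: move=> /rsat_And[HB HD] /rsat_And[HB' HD'] A.
all: rewrite in_cons => /orP[/eqP->|]; first by move: HB HB' => /=; tauto.
all: exact: IH HD HD' _.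
Qed.

Definition terms n : seq term := Zero :: Max :: map Var (iota 0 n).

Lemma mem_terms n t : tbound t <= n -> t \in terms n.
Proof.
case: t => [i|//|//] /= Hi; rewrite !in_cons map_f ?orbT // mem_iota; lia.
Qed.

Definition atoms n : seq (form Sigma) :=
  Bot :: [seq Eq t u | t <- terms n, u <- terms n] ++
  [seq Succ t u | t <- terms n, u <- terms n] ++
  [seq Path t u | t <- terms n, u <- terms n] ++
  [seq Letter a t | a <- enum Sigma, t <- terms n].

Arguments atoms : simpl never.

Lemma mem_atoms n A : atomic A -> fbound A <= n -> A \in atoms n.
Proof.
rewrite /atoms; move: (terms n) (@mem_terms n) => T HT.
case: A => //= [t u|t u|t u|a t]; rewrite ?geq_max in_cons !mem_cat //.
1-3: move=> _ /andP[/HT Ht /HT Hu].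
4: move=> _ /HT Ht; move: (mem_enum Sigma a) => Ha.
- by rewrite (allpairs_f (@Eq Sigma) Ht Hu) ?orbT.
- by rewrite (allpairs_f (@Succ Sigma) Ht Hu) ?orbT.
- by rewrite (allpairs_f (@Path Sigma) Ht Hu) ?orbT.
- by rewrite (allpairs_f (@Letter Sigma) Ha Ht) ?orbT.
Qed.

(** A finite list that determines the rank-[k] type of [n] pebbles, in the manner of Hintikka
    formulas: it records the atomic facts and which complete descriptions over [rank_forms k' n.+1]
    are realised by one more pebble. *)
Fixpoint rank_forms k n : seq (form Sigma) :=
  atoms n ++ (if k is k'.+1 then
    map (@Ex Sigma) (sign_conjs (rank_forms k' n.+1)) else [::]).

Lemma mem_rank_atoms k n A :
  atomic A -> fbound A <= n -> A \in rank_forms k n.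
Proof.
by move=> atA An; case: k => [|k];
  rewrite -[rank_forms _ _]/(atoms n ++ _) mem_cat mem_atoms.
Qed.

(** The converse half: a move of the spoiler realises some complete description [C], and since
    [Ex C] is in the list, the other segment has an answer that realises the same [C]. *)
Lemma rank_forms_bf M N (u : M) (v : N) k : forall n rho sigma,
  (forall A, A \in rank_forms k n -> rsat u rho A <-> rsat v sigma A) ->
  bf k n u v rho sigma.
Proof.
elim: k => [|k IH] n rho sigma H /=; split.
1,3: by move=> A atA An; apply: H; apply: mem_rank_atoms.
- by [].
have {}H C : C \in sign_conjs (rank_forms k n.+1) ->
    rsat u rho (Ex C) <-> rsat v sigma (Ex C).
  move=> HC; apply: H.
  by rewrite -[rank_forms _ _]/(atoms n ++ _) mem_cat map_f ?orbT.
split=> x Px.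
- have [C Cs HC] := sign_conjs_ex u (scons x rho) (rank_forms k n.+1).
  have [y Py HC'] := iffLR (rsat_Ex _ _ _) (iffLR (H C Cs)
    (iffRL (rsat_Ex _ _ _) (ex_intro2 _ _ x Px HC))).
  by exists y => //; apply: IH; apply: sign_conjs_agree Cs HC HC'.
- have [C Cs HC] := sign_conjs_ex v (scons x sigma) (rank_forms k n.+1).
  have [y Py HC'] := iffLR (rsat_Ex _ _ _) (iffRL (H C Cs)
    (iffRL (rsat_Ex _ _ _) (ex_intro2 _ _ x Px HC))).
  by exists y => //; apply: IH; apply: sign_conjs_agree Cs HC' HC.
Qed.

(** The segment up to [u'] is the segment up to [u] with one new last element. Apart from letters,
    these clauses settle all atomic facts about [u'], so the composition argument treats a model of
    the axioms and a word alike. *)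
Record end_step M (u u' : M) : Prop := EndStep {
  step_path : forall x, path_of x u' <-> path_of x u \/ x = u';
  step_refl : path_of u u;
  step_zero : path_of (zero_of M) u;
  step_pathN : forall x, path_of x u -> ~ path_of u' x;
  step_succ : forall x, path_of x u -> succ_of x u' <-> x = u;
  step_succN : forall x, path_of x u' -> ~ succ_of u' x }.

Lemma end_step_neq M (u u' x : M) : end_step u u' -> path_of x u -> x <> u'.
Proof.
move=> S Px E; rewrite E in Px; apply: (step_pathN S Px).
by apply/(step_path S); right.
Qed.

(** The hypothesis on [rho] and [sigma] is the invariant of the composed game: each pebble pair lies
    on the two new elements or copies a pair of the game on the shorter segments. Terms inherit this
    dichotomy, with [Max] denoting the new element. *)
Lemma reval_lower M N (u u' : M) (v v' : N) n n0 rho sigma rho0 sigma0 :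
  end_step u u' -> end_step v v' ->
  (forall j, j < n -> rho j = u' /\ sigma j = v' \/
     exists2 m, m < n0 & [/\ path_of (rho0 m) u, path_of (sigma0 m) v,
       rho j = rho0 m & sigma j = sigma0 m]) ->
  forall t, tbound t <= n ->
    reval u' rho t = u' /\ reval v' sigma t = v' \/
    exists2 t0, tbound t0 <= n0 & [/\ path_of (reval u rho0 t0) u,
      path_of (reval v sigma0 t0) v, reval u' rho t = reval u rho0 t0 &
      reval v' sigma t = reval v sigma0 t0].
Proof.
move=> Su Sv R [j /R[K|[m m0 K]]|_|_] /=.
- by left.
- by right; exists (Var m).
- by right; exists Zero => //; split=> //; apply: step_zero; eassumption.
- by left.
Qed.

Lemma atomic_end_step M N (u u' : M) (v v' : N) n n0 rho sigma rho0 sigma0 A :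
  end_step u u' -> end_step v v' ->
  (forall a, letter_of a u' <-> letter_of a v') ->
  (forall B, atomic B -> fbound B <= n0 ->
     (rsat u rho0 B <-> rsat v sigma0 B)) ->
  (forall j, j < n -> rho j = u' /\ sigma j = v' \/
     exists2 m, m < n0 & [/\ path_of (rho0 m) u, path_of (sigma0 m) v,
       rho j = rho0 m & sigma j = sigma0 m]) ->
  atomic A -> fbound A <= n -> rsat u' rho A <-> rsat v' sigma A.
Proof.
move=> Su Sv L H R; have T := reval_lower Su Sv R.
have Ru : path_of u' u' by apply/(step_path Su); right.
have Rv : path_of v' v' by apply/(step_path Sv); right.
case: A => //= [t s|t s|t s|a t]; rewrite ?geq_max => _.
(* Each binary symbol gives four cases, since each argument is the new element or a term over the
   old segment. *)
1-3: move=> /andP[/T[[-> ->]|[t0 t0n [Pt Qt -> ->]]]].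
1-6: move=> /T[[-> ->]|[s0 s0n [Ps Qs -> ->]]].
all: try by split.
- by split=> E; [have := end_step_neq Su Ps|have := end_step_neq Sv Qs];
    rewrite E.
- by split=> E; [have := end_step_neq Su Pt|have := end_step_neq Sv Qt];
    rewrite E.
- by apply: (H (Eq t0 s0)); rewrite //= geq_max t0n.
- by split=> K; [case: (step_succN Su Ru K)|case: (step_succN Sv Rv K)].
- have Ps' : path_of (reval u rho0 s0) u' by apply/(step_path Su); left.
  have Qs' : path_of (reval v sigma0 s0) v' by apply/(step_path Sv); left.
  by split=> K; [case: (step_succN Su Ps' K)|case: (step_succN Sv Qs' K)].
(* A predecessor of the new element is the old endpoint, which the shorter game names [Max]; so a
   successor fact becomes an equation there. *)
- rewrite (step_succ Su Pt) (step_succ Sv Qt).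
  by apply: (H (Eq t0 Max)); rewrite //= maxn0.
- by apply: (H (Succ t0 s0)); rewrite //= geq_max t0n.
- by split=> K; [case: (step_pathN Su Ps K)|case: (step_pathN Sv Qs K)].
- by rewrite (step_path Su) (step_path Sv); split=> _; left.
- by apply: (H (Path t0 s0)); rewrite //= geq_max t0n.
- move=> /T[[-> ->]|[t0 t0n [Pt Qt -> ->]]] //.
  exact: (H (Letter a t0)).
Qed.

(** The duplicator answers the new element by the new element, and any other move by the strategy
    for the shorter segments. *)
Lemma bf_end_step M N (u u' : M) (v v' : N) k :
  end_step u u' -> end_step v v' ->
  (forall a, letter_of a u' <-> letter_of a v') ->
  forall n n0 rho sigma rho0 sigma0, bf k n0 u v rho0 sigma0 ->
  (forall j, j < n -> rho j = u' /\ sigma j = v' \/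
     exists2 m, m < n0 & [/\ path_of (rho0 m) u, path_of (sigma0 m) v,
       rho j = rho0 m & sigma j = sigma0 m]) ->
  bf k n u' v' rho sigma.
Proof.
move=> Su Sv L; elim: k => [|k IH] n n0 rho sigma rho0 sigma0 H R /=.
all: split; [move=> A atA An; apply: (atomic_end_step Su Sv L _ R) => // B;
             exact: bf_atomic H | ].
  by [].
case: H => _ [fw bw].
have Rs x y x0 y0 : x = u' /\ y = v' \/
    [/\ path_of x0 u, path_of y0 v, x = x0 & y = y0] ->
  forall j, j < n.+1 -> scons x rho j = u' /\ scons y sigma j = v' \/
     exists2 m, m < n0.+1 & [/\ path_of (scons x0 rho0 m) u,
       path_of (scons y0 sigma0 m) v, scons x rho j = scons x0 rho0 m &
       scons y sigma j = scons y0 sigma0 m].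
  move=> K [_ /=|j /R[|[m m0 K']]]; last by right; exists m.+1.
  - by case: K => K; [left|right; exists 0].
  - by left.
split=> x /step_path Px.
- have [Pxu|->] := Px _ Su.
  + have [y Py H] := fw x Pxu; exists y; first by apply/(step_path Sv); left.
    by apply: IH H _; apply: Rs; right.
  (* The reply to [u'] is [v']. The shorter game must still go down to [k] rounds, so a dummy move
     on [u] is played in it. *)
  + have [y Py H] := fw u (step_refl Su).
    exists v'; first by apply/(step_path Sv); right.
    by apply: IH H _; apply: Rs; left.
- have [Pxv|->] := Px _ Sv.
  + have [y Py H] := bw x Pxv; exists y; first by apply/(step_path Su); left.
    by apply: IH H _; apply: Rs; right.
  + have [y Py H] := bw v (step_refl Sv).
    exists u'; first by apply/(step_path Su); right.
    by apply: IH H _; apply: Rs; left.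
Qed.

End Relativization.

(** * Words and inductive models *)

Section Rank.
Variable Sigma : finType.
Implicit Types A B C : form Sigma.

Lemma atoms_rank n A :
  A \in atoms Sigma n -> (qrank A <= 0) && (fbound A <= n).
Proof.
have T t : t \in terms n -> tbound t <= n.
  rewrite !in_cons => /or3P[/eqP->|/eqP->|/mapP[i]] //.
  by rewrite mem_iota => Hi -> /=; lia.
rewrite /atoms; move: (terms n) T => s T.
rewrite in_cons !mem_cat => /orP[/eqP->//|].
move=> /or4P[] /allpairsPdep[x [y [Hx Hy ->]]] /=.
1-3: by rewrite geq_max !T.
exact: T.
Qed.

Lemma sign_conjs_rank k n (s : seq (form Sigma)) :
  {in s, forall A, (qrank A <= k) && (fbound A <= n)} ->
  {in sign_conjs s, forall A, (qrank A <= k) && (fbound A <= n)}.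
Proof.
elim: s => [_ A|B s IH H A] /=; first by rewrite inE => /eqP->.
have /andP[HB1 HB2] := H B (mem_head _ _).
rewrite mem_cat => /orP[] /mapP[C /IH HC ->] /=.
all: have /andP[HC1 HC2] : (qrank C <= k) && (fbound C <= n)
  by apply: HC => D Ds; apply: H; rewrite in_cons Ds orbT.
all: lia.
Qed.

(** With this bound [bf_rsat] applies to the formulas in the list, and by [sign_conjs_rank] to the
    complete descriptions over it. *)
Lemma rank_forms_rank k n :
  {in rank_forms Sigma k n, forall A, (qrank A <= k) && (fbound A <= n)}.
Proof.
elim: k n => [|k IH] n A; rewrite -[rank_forms _ _ _]/(atoms _ n ++ _) mem_cat.
  by rewrite orbF => /atoms_rank.
move=> /orP[/atoms_rank/andP[H ->]|]; first by rewrite andbT; lia.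
by move=> /mapP[C /(sign_conjs_rank (IH _))/andP[H1 H2] ->] /=; lia.
Qed.

End Rank.

Section WordModel.
Variables (Sigma : finType).

Lemma TC_word_model n (w : n.+1.-tuple Sigma) : TC_model (word_model w).
Proof.
move=> x y; split=> [|H]; last first.
  by elim: H => //= [{}x {}y ->|{}x {}y z _ + _]; [lia|apply: leq_trans].
(* [y] becomes [inord] of the distance plus [x], which makes room for induction on the distance. *)
rewrite /= => xy; rewrite -(inord_val y) -(subnK xy).
move: (ltn_ord y); rewrite -{1}(subnK xy).
elim: (y - x) => [|d IH] Hd; first by rewrite add0n inord_val; apply: rt_refl.
apply: (rt_trans _ _ _ (inord (d + x) : 'I_n.+1)); first by apply: IH; lia.
by apply: rt_step; rewrite /= !inordK; lia.
Qed.

Lemma word_model_axioms n (w : n.+1.-tuple Sigma) :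
  word_axioms (word_model w).
Proof.
split=> //=.
- by move=> x; have := ltn_ord x; lia.
- move=> x x0; have {}x0 : x != 0 :> nat.
    by apply/eqP => E; apply: x0; apply: val_inj.
  by exists (inord x.-1); rewrite inordK; have := ltn_ord x; lia.
- move=> x xn; have {}xn : x != n :> nat.
    by apply/eqP => E; apply: xn; apply: val_inj.
  by exists (inord x.+1); rewrite inordK; have := ltn_ord x; lia.
- by move=> x y z Hy Hz; apply: val_inj; rewrite /= Hy Hz.
- by move=> x y z Hy Hz; apply: val_inj => /=; lia.
- by move=> x; rewrite -ltnS.
- by move=> x; exists (tnth w x) => b; split=> ->.
Qed.

Lemma word_model_end_step n (w : n.+2.-tuple Sigma) :
  @end_step Sigma (word_model w) (inord n) ord_max.
Proof.
split=> /=; rewrite ?inordK //.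
- move=> x; have := ltn_ord x; rewrite ltnS => xn; split=> // _.
  have [E|E] := eqVneq (x : nat) n.+1; [right; exact: val_inj|left; lia].
- by move=> x ?; lia.
- move=> x xn; split=> [E|->]; last by rewrite inordK.
  by apply: val_inj; rewrite /= inordK; lia.
- by move=> x ? ?; lia.
Qed.

(** Equality of positions is an isomorphism from [w] onto the segment of [rcons w a] that omits the
    last letter. *)
Lemma rsat_rcons n (w : n.+1.-tuple Sigma) a (sigma : nat -> 'I_n.+1) A :
  @rsat Sigma (word_model w) ord_max sigma A <->
  @rsat Sigma (word_model [tuple of rcons w a]) (inord n)
    (fun i => inord (sigma i)) A.
Proof.
apply: (@rsat_iso Sigma (word_model w) (word_model [tuple of rcons w a]) _ _
  (fun x y => x = y :> nat)) => /=.
- by [].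
- by rewrite inordK.
- by move=> x xn; exists (inord x); rewrite /= !inordK; have := ltn_ord x; lia.
- move=> y; rewrite inordK // => yn; exists (inord y);
    rewrite /= ?inordK //; lia.
- move=> x y x' y' E E'; split; rewrite ?E ?E' //.
  + split=> K; apply: val_inj => /=; last by rewrite E E' K.
    by rewrite -E -E' K.
  + move=> b; rewrite !(tnth_nth b) /= nth_rcons size_tuple -E.
    by rewrite (ltn_ord x).
- by move=> i; rewrite inordK //; have := ltn_ord (sigma i); lia.
Qed.

End WordModel.

(** * Paths and word types in models of induction *)

Section InductiveModel.
Variables (Sigma : finType) (M : structure Sigma).
Hypothesis MA : word_axioms M.
Hypothesis MT1 : forall u v : M, path_of u v <->
  u = v \/ exists2 w, succ_of u w & path_of w v.
(** This is [Ind] with [Z] equal to [P]: a property closed under successor spreads along paths from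
    any point that has it. *)
Hypothesis MInd : forall P (rho : nat -> M),
  (forall u v, sat (scons u rho) P -> succ_of u v -> sat (scons v rho) P) ->
  forall u w, sat (scons w rho) P -> path_of w u -> sat (scons u rho) P.

Lemma path_refl (u : M) : path_of u u.
Proof. by apply/MT1; left. Qed.

Lemma path_succ (u w v : M) : succ_of u w -> path_of w v -> path_of u v.
Proof. by move=> uw wv; apply/MT1; right; exists w. Qed.

(** Induction along the path from [u] to [v], on the property of [x] that everything reachable from
    [x] is reachable from [u]. *)
Lemma path_trans (u v w : M) : path_of u v -> path_of v w -> path_of u w.
Proof.
move=> uv; apply: (MInd (P := All (Imp (Path #1 #0) (Path #2 #0))%fo)
  (rho := fun _ => u) _ _ uv) => //= x y H xy z yz.
by apply: H; apply: path_succ yz.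
Qed.

(** [T1] splits off the first step of a path. The last step comes by induction on the property of
    [x] that, unless [x] is [u], some predecessor of [x] is reachable from [u]. *)
Lemma path_last (u v : M) :
  path_of u v -> u = v \/ exists2 w, path_of u w & succ_of w v.
Proof.
move=> uv; have := MInd (P := (Imp (Neg (Eq #1 #0))
  (Neg (All (Imp (Path #2 #0) (Neg (Succ #0 #1))))))%fo)
  (rho := fun _ => u) _ _ uv.
rewrite /= => H; have [->|uNv] := pselect (u = v); [by left|right].
apply: contrapT => K; apply: H uNv _ => //; last first.
  by move=> w uw wv; apply: K; exists w.
move=> x y Hx xy _ Hy; apply: (Hy x) => //.
have [->|ux] := pselect (u = x); first exact: path_refl.
apply: contrapT => uxN; apply: Hx => // w uw wx.
apply: uxN; apply: path_trans uw _; apply: path_succ wx (path_refl _).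
Qed.

(** Induction on [v], starting from zero, which has no predecessor. A cycle through the edge from
    [x] to [y] has a last step into [x]; read from there, it is a cycle through an edge ending at
    [x], which the induction hypothesis excludes. *)
Lemma path_acyclic (u v : M) : succ_of u v -> ~ path_of v u.
Proof.
move: u; apply: (MInd (P := All (Imp (Succ #0 #1) (Neg (Path #1 #0)))%fo)
  (rho := fun _ => v) _ _ (path_zero MA v)) => /=; last first.
  by move=> z /(succ_zeroN MA).
move=> x y H xy z zy.
rewrite (succ_inj MA zy xy) => /path_last[E|[w yw wx]].
  by rewrite E in xy; apply: (H x xy (path_refl x)).
by apply: (H w wx); apply: path_succ yw.
Qed.

Lemma succ_end_step (u v : M) : succ_of u v -> end_step u v.
Proof.
move=> uv; split.
- move=> x; split=> [/path_last[->|[w xw wv]]|[xu|->]].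
  + by right.
  + by left; rewrite -(succ_inj MA wv uv).
  + by apply: path_trans xu _; apply: path_succ uv (path_refl _).
  + exact: path_refl.
- exact: path_refl.
- exact: path_zero.
- by move=> x xu vx; apply: (path_acyclic uv); apply: path_trans xu.
- by move=> x xu; split=> [xv|->//]; apply: succ_inj xv uv.
- by move=> x xv /path_acyclic.
Qed.

(* The initial segment bounded by #0 has the rank-k type of a word: each
   conjunction in [sign_conjs (rank_forms Sigma k 0)] determines that type. *)
Definition wordlike k : form Sigma :=
  \big[@Or Sigma/Bot]_(C <- sign_conjs (rank_forms Sigma k 0) |
      `[< exists n (w : n.+1.-tuple Sigma) sigma,
            @rsat Sigma (word_model w) ord_max sigma C >]) relativize 0 C.

Lemma sat_wordlike k (u : M) rho :
  sat (scons u rho) (wordlike k) <->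
  exists n (w : n.+1.-tuple Sigma) sigma,
    @bf Sigma k 0 M (word_model w) u ord_max (scons u rho) sigma.
Proof.
rewrite sat_bigOr; split.
  move=> [C [Cs /asboolP[n [w [sigma HC]]] /sat_relativize HC']].
  exists n, w, sigma; apply: rank_forms_bf.
  exact: sign_conjs_agree Cs HC' HC.
move=> [n [w [sigma H]]].
have [C Cs HC] := sign_conjs_ex u (scons u rho) (rank_forms Sigma k 0).
exists C; split=> //; last exact/sat_relativize.
have /andP[Ck C0] := sign_conjs_rank (@rank_forms_rank _ _ _) Cs.
apply/asboolP; exists n, w, sigma.
exact: (iffLR (bf_rsat H Ck C0)).
Qed.

Lemma bf_zero k a : letter_of a (zero_of M) ->
  @bf Sigma k 0 M (word_model [tuple a]) (zero_of M) ord_max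
    (fun _ => zero_of M) (fun _ => ord_max).
Proof.
move=> La; apply: rank_forms_bf => A _.
have [b Lb] := letter_ex MA (zero_of M).
apply: (@rsat_iso Sigma M (word_model [tuple a]) _ _
  (fun x _ => x = zero_of M)) => //=.
(* Only zero lies below zero, since a last step would give it a predecessor. *)
- move=> x /path_last[->|[w _ /(succ_zeroN MA)//]]; by exists ord0.
- by move=> y _; exists (zero_of M) => //; apply: path_refl.
- move=> x y x' y' -> ->; rewrite !ord1; split=> //.
  + by split=> // /(succ_zeroN MA).
  + by split=> // _; apply: path_refl.
  + move=> c; rewrite Lb (tnth_nth a) /= -(iffLR (Lb a) La).
    by split=> ->.
Qed.

Lemma bf_word k (u : M) : exists rho n (w : n.+1.-tuple Sigma) sigma,
  @bf Sigma k 0 M (word_model w) u ord_max rho sigma.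
Proof.
pose z := zero_of M.
suff /sat_wordlike[n [w [sigma H]]] : sat (scons u (fun _ => z)) (wordlike k).
  by exists (scons u (fun _ => z)), n, w, sigma.
apply: MInd (path_zero MA u) => [x y /sat_wordlike[n [w [sigma H]]] xy|].
- have [a La] := letter_ex MA y.
  (* The word grows by the letter [a] of [y]. No pebble is placed yet, so any valuation serves. *)
  apply/sat_wordlike; exists n.+1, [tuple of rcons w a], (fun _ => ord_max).
  apply: (@bf_end_step _ _ _ _ _ _ _ k (succ_end_step xy)
    (word_model_end_step _) _ 0 0 _ _ (scons x (fun _ => z))
    (fun i => inord (sigma i))) => //.
  + move=> b; rewrite La /= (tnth_nth a) /= nth_rcons size_tuple ltnn eqxx.
    by split=> ->.
  (* The induction hypothesis speaks of [w] as a whole; it is carried over to [w] as a prefix of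
     [rcons w a]. *)
  + apply: rank_forms_bf => A /rank_forms_rank/andP[Ak A0].
    by rewrite (bf_rsat H Ak A0); apply: rsat_rcons.
- apply/sat_wordlike; have [a La] := letter_ex MA z.
  exists 0, [tuple a], (fun _ => ord_max).
  have -> : scons z (fun _ => z) = fun _ => z by apply: funext => -[].
  by apply: bf_zero; apply/La.
Qed.

(** The segment up to [max_of M] is all of [M], and the game of [qrank psi] rounds decides [psi]. *)
Lemma word_equivalent psi : sentence psi ->
  exists n (w : n.+1.-tuple Sigma), models M psi <-> models (word_model w) psi.
Proof.
move=> psi0; have [rho [n [w [sigma H]]]] := bf_word (qrank psi) (max_of M).
have := bf_rsat (A := psi) H (leqnn _); rewrite psi0 => /(_ (leqnn _)).
rewrite (rsat_top _ (path_max MA)) // (@rsat_top _ (word_model w) ord_max) //;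
  last by move=> x; apply: (path_max (word_model_axioms w)).
move=> E; exists n, w; split=> K.
- by apply: (models_sentence (rho := sigma) psi0); apply/E.
- by apply: (models_sentence (rho := rho) psi0); apply/E.
Qed.

End InductiveModel.

(** * Truth in TC models and truth in words *)

Section Models.
Variable Sigma : finType.
Implicit Type M : structure Sigma.

Lemma inductive_word_equivalent M psi (x0 : M) :
  models M (A_word Sigma) -> models M (T1 Sigma) ->
  (forall P, models M (Ind P P)) -> sentence psi ->
  exists n (w : n.+1.-tuple Sigma), models M psi <-> models (word_model w) psi.
Proof.
move=> /(models_A_word x0) MA /models_T1 MT1 MInd; apply: word_equivalent => //.
move=> P rho HP.
exact: (iffLR (models_Ind _ _ _) (MInd P) rho (fun _ => id) HP).
Qed.

Lemma TC_model_T1 M : TC_model M -> models M (T1 Sigma).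
Proof.
move=> TC; apply/models_T1 => u v; rewrite TC; split.
- move/(@clos_rt_rt1n _ _ _ _); case=> [|w z uw]; first by left.
  by move/(@clos_rt1n_rt _ _ _ _)/TC => wz; right; exists w.
- case=> [->|[w uw /TC wv]]; first exact: rt_refl.
  by apply: rt_trans wv; apply: rt_step.
Qed.

Lemma TC_model_Ind M Z P : TC_model M -> models M (Ind Z P).
Proof.
move=> TC; apply/models_Ind => rho HZ HP u w /HZ Pw /TC wu.
by elim: wu Pw => [x y xy /HP|x|x y z _ IH1 _ IH2 /IH1 /IH2] //; apply.
Qed.

Lemma TC_valid_words psi : sentence psi ->
  TC_valid (A_word Sigma) psi <->
  forall n (w : n.+1.-tuple Sigma), models (word_model w) psi.
Proof.
move=> psi0; split=> [H n w|H M TC MA rho].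
- apply: H; first exact: TC_word_model.
  by apply/(@models_A_word _ (word_model w) ord0); apply: word_model_axioms.
- have [n [w E]] := inductive_word_equivalent (rho 0) MA (TC_model_T1 TC)
    (fun P => @TC_model_Ind M P P TC) psi0.
  by apply: (iffRL E (H n w)).
Qed.

End Models.

(** * Derivations *)

Section Substitution.
Variable Sigma : finType.
Implicit Types (A B : form Sigma) (f g : nat -> term).

Definition up f : nat -> term := scons (Var 0) (fun i => tshift (f i)).

Lemma up_Var : up Var = Var.
Proof. by apply: funext => -[]. Qed.

Lemma tsubst_tsubst f g t :
  tsubst g (tsubst f t) = tsubst (fun i => tsubst g (f i)) t.
Proof. by case: t. Qed.

Lemma up_comp f g : (fun i => tsubst (up g) (up f i)) =
  up (fun i => tsubst g (f i)).
Proof. by apply: funext => -[|i] //=; rewrite !tsubst_tsubst; case: (f i). Qed.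

Lemma subst_subst A : forall f g,
  subst g (subst f A) = subst (fun i => tsubst g (f i)) A.
Proof.
elim: A => /= [|t u|t u|t u|a t|B IB C IC|B IB] f g;
  rewrite ?tsubst_tsubst ?IB ?IC //.
by rewrite -/(up f) -/(up g) up_comp.
Qed.

Lemma tsubst_bound t f g :
  (forall i, i < tbound t -> f i = g i) -> tsubst f t = tsubst g t.
Proof. by case: t => //= i; apply. Qed.

Lemma subst_bound A : forall f g,
  (forall i, i < fbound A -> f i = g i) -> subst f A = subst g A.
Proof.
elim: A => //= [t u|t u|t u|a t|B IB C IC|B IB] f g E.
1-3: by rewrite !(@tsubst_bound _ f g) // => i Hi; apply: E;
  rewrite leq_max Hi ?orbT.
- by rewrite (@tsubst_bound _ f g).
- by rewrite (IB f g) 1?(IC f g) // => i Hi; apply: E; rewrite leq_max Hi ?orbT.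
- by rewrite (IB _ (up g)) // => -[|i] //= Hi; rewrite E //; lia.
Qed.

Lemma subst_Var A : subst Var A = A.
Proof.
have E t : tsubst Var t = t by case: t.
elim: A => //= [t u|t u|t u|a t|B IB C IC|B IB]; rewrite ?E ?IB ?IC //.
by rewrite -/(up Var) up_Var IB.
Qed.

Lemma subst_inst A f t :
  subst f (inst t A) = inst (tsubst f t) (subst (up f) A).
Proof.
rewrite /inst !subst_subst; congr subst; apply: funext => -[|i] //=.
by rewrite tsubst_tsubst /=; case: (f i).
Qed.

Lemma subst_shift A f : subst (up f) (shift A) = shift (subst f A).
Proof. by rewrite /shift !subst_subst. Qed.

Lemma inst_up A f t : inst t (subst (up f) A) = subst (scons t f) A.
Proof.
rewrite /inst subst_subst; congr subst; apply: funext => -[|i] //=.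
by rewrite tsubst_tsubst /=; case: (f i).
Qed.

End Substitution.

Section Deduction.
Variable Sigma : finType.
Implicit Types (A B : form Sigma) (G : seq (form Sigma)).

Lemma deriv_weaken G A : deriv G A ->
  forall G', List.incl G G' -> deriv G' A.
Proof.
elim=> {G A} [G A GA|G A B _ IH|G A B _ IH1 _ IH2|G A _ IH|G A _ IH|G A t _ IH|
  G t|G A t u _ IH1 _ IH2] G' GG'.
- by apply: deriv_hyp; apply: GG'.
- by apply: deriv_impI; apply: IH => x [|/GG']; [left|right].
- by apply: deriv_impE (IH1 _ GG') (IH2 _ GG').
- by apply: deriv_raa; apply: IH => x [|/GG']; [left|right].
- apply: deriv_allI; apply: IH => x.
  by rewrite !List.in_map_iff => -[y [<- /GG' H]]; exists y.
- by apply: deriv_allE; apply: IH.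
- exact: deriv_eqI.
- by apply: deriv_eqE (IH1 _ GG') (IH2 _ GG').
Qed.

Lemma deriv_subst G A : deriv G A ->
  forall f, deriv (map (subst f) G) (subst f A).
Proof.
elim=> {G A} [G A GA|G A B _ IH|G A B _ IH1 _ IH2|G A _ IH|G A _ IH|G A t _ IH|
  G t|G A t u _ IH1 _ IH2] f /=.
- by apply: deriv_hyp; apply: List.in_map.
- by apply: deriv_impI; apply: (IH f).
- by apply: deriv_impE (IH1 f) (IH2 f).
- by apply: deriv_raa; apply: (IH f).
- apply: deriv_allI; have := IH (up f); rewrite -!map_comp.
  by rewrite (eq_map (fun A => subst_shift A f)).
- by rewrite subst_inst; apply: deriv_allE; apply: (IH f).
- exact: deriv_eqI.
- rewrite subst_inst; apply: (deriv_eqE (IH1 f)).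
  by have := IH2 f; rewrite subst_inst.
Qed.

Lemma deriv_exfalso G A : deriv G Bot -> deriv G A.
Proof. by move=> H; apply: deriv_raa; apply: (deriv_weaken H) => x; right. Qed.

Lemma deriv_eq_sym G t u : deriv G (Eq t u) -> deriv G (Eq u t).
Proof.
(* Leibniz's rule in the context where [#0] equals [t] turns reflexivity at [t] into the reversed
   equation. *)
move=> H; have := @deriv_eqE _ G (Eq #0 (tshift t))%fo t u H.
have E s : tsubst (scons s Var) (tshift t) = t by case: t {H}.
by rewrite /inst /= !E; apply; apply: deriv_eqI.
Qed.

(** Commutation with substitution lets [R] serve as a context for Leibniz's rule, so one proof
    covers every atomic symbol. *)
Lemma deriv_rewr (R : term -> term -> form Sigma) G t t' u u' :
  (forall f a b, subst f (R a b) = R (tsubst f a) (tsubst f b)) ->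
  deriv G (Eq t t') -> deriv G (Eq u u') -> deriv G (R t u) ->
  deriv G (R t' u').
Proof.
have E (s a : term) : tsubst (scons s Var) (tshift a) = a by case: a.
move=> RE Ht Hu H.
have H1 : deriv G (R t' u).
  have := @deriv_eqE _ G (R #0 (tshift u))%fo t t' Ht.
  by rewrite /inst !RE /= !E; apply.
have := @deriv_eqE _ G (R (tshift t') #0)%fo u u' Hu.
by rewrite /inst !RE /= !E; apply.
Qed.

Lemma deriv_generalize G A c :
  (forall B, List.In B G -> fbound B <= c) -> fbound A <= c.+1 ->
  deriv G (inst (Var c) A) -> deriv G (All A).
Proof.
move=> Gc Ac /deriv_subst.
(* The fresh variable [c] becomes the bound one and all others move up. Where [c] does not occur,
   this is [shift]. *)
pose f i := if i == c then Var 0 else Var i.+1.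
move=> /(_ f) H; apply: deriv_allI.
have EA : subst f (inst (Var c) A) = A.
  rewrite /inst subst_subst -[RHS]subst_Var; apply: subst_bound => -[|i] Hi /=.
    by rewrite /f eqxx.
  by rewrite /f; case: eqP => // E; lia.
have EG : map (subst f) G = map (@shift Sigma) G.
  apply: List.map_ext_in => B /Gc Bc; apply: subst_bound => i Hi.
  by rewrite /f; case: eqP => // E; lia.
by rewrite EA EG in H.
Qed.

End Deduction.

(** * Completeness *)

Section Henkin.
Variables (Sigma : finType) (T : theory Sigma).
Hypothesis T_sentence : forall B, T B -> sentence B.
Implicit Types (A B C : form Sigma) (S : seq (form Sigma)).

Definition entails S A : Prop :=
  exists2 G, (forall B, List.In B G -> T B) & deriv (S ++ G) A.

Lemma entails_hyp S A : List.In A S -> entails S A.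
Proof.
move=> SA; exists [::] => //; apply: deriv_hyp.
by apply/List.in_app_iff; left.
Qed.

Lemma entails_theory S A : T A -> entails S A.
Proof.
move=> TA; exists [:: A] => [B [<-|[]]//|]; apply: deriv_hyp.
by apply/List.in_app_iff; right; left.
Qed.

Lemma entails_sub S S' A : List.incl S S' -> entails S A -> entails S' A.
Proof.
move=> SS' [G TG H]; exists G => //; apply: deriv_weaken H _ _ => B.
by rewrite !List.in_app_iff => -[/SS'|]; [left|right].
Qed.

Lemma entails_map S A B : (forall G, deriv G A -> deriv G B) ->
  entails S A -> entails S B.
Proof. by move=> AB [G TG H]; exists G => //; apply: AB. Qed.

Lemma entails_map2 S A B C :
  (forall G, deriv G A -> deriv G B -> deriv G C) ->
  entails S A -> entails S B -> entails S C.
Proof.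
move=> ABC [G TG HA] [G' TG' HB]; exists (G ++ G').
  by move=> D /List.in_app_iff[/TG|/TG'].
apply: ABC.
- apply: (deriv_weaken HA) => D; rewrite !List.in_app_iff; tauto.
- apply: (deriv_weaken HB) => D; rewrite !List.in_app_iff; tauto.
Qed.

Lemma entails_impI S A B : entails (A :: S) B -> entails S (Imp A B).
Proof. by move=> [G TG H]; exists G => //; apply: deriv_impI. Qed.

Lemma entails_raa S A : entails (Neg A :: S) Bot -> entails S A.
Proof. by move=> [G TG H]; exists G => //; apply: deriv_raa. Qed.

Lemma entails_generalize S A c :
  (forall B, List.In B S -> fbound B <= c) -> fbound A <= c.+1 ->
  entails S (inst (Var c) A) -> entails S (All A).
Proof.
move=> Sc Ac [G TG H]; exists G => //; apply: deriv_generalize H => // B.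
by move=> /List.in_app_iff[/Sc//|/TG/T_sentence ->].
Qed.

Variable psi : form Sigma.
Hypothesis psi_unprovable : ~ provable T psi.

Definition fresh S : nat := foldr (fun B m => maxn (fbound B) m) 0 S.

Lemma fbound_fresh S B : List.In B S -> fbound B <= fresh S.
Proof.
elim: S => //= A S IH [->|/IH H]; first exact: leq_maxl.
exact: leq_trans H (leq_maxr _ _).
Qed.

(* [T] consists of sentences, so the variables can serve as Henkin constants:
   when [All B] is refuted, a counterexample is named by a fresh one. *)
Fixpoint stage n : seq (form Sigma) :=
  if n is m.+1 then
    let S := stage m in
    if unpickle m is Some A then
      if `[< entails (A :: S) Bot >] then
        if A is All B then Neg (inst (Var (fresh (B :: S))) B) :: S else S
      else A :: S
    else S
  else [:: Neg psi].

(** The critical case is a refuted [All B]: if its named counterexample were inconsistent, the fresh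
    variable could be generalized, [All B] would follow, and the previous stage would be
    inconsistent. *)
Lemma stage_consistent n : ~ entails (stage n) Bot.
Proof.
elim: n => [|n IH] /=.
  by move=> /entails_raa[G TG H]; apply: psi_unprovable; exists G.
case: unpickle => // A; case: asboolP => // incA; case: A incA => // B incB.
move=> /entails_raa/entails_generalize H; apply: IH.
apply: (entails_map2 _ (entails_impI incB)).
  by move=> G; apply: deriv_impE.
apply: H => [C SC|].
  by apply: (@fbound_fresh (B :: stage n)); right.
by apply: leqW; apply: (@fbound_fresh (B :: stage n)); left.
Qed.

Lemma stage_sub m n : m <= n -> List.incl (stage m) (stage n).
Proof.
move=> /subnK <-; elim: (n - m) => [|d IH] // A /IH H.
rewrite addSn /=; case: unpickle => // B.
by case: asboolP => _; [case: B => // C|]; right.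
Qed.

(** The deductive closure of the union of all stages, a maximal consistent theory with witnesses. *)
Definition henkin A : Prop := exists n, entails (stage n) A.

Lemma henkin_theory A : T A -> henkin A.
Proof. by exists 0; apply: entails_theory. Qed.

Lemma henkin_psi : henkin (Neg psi).
Proof. by exists 0; apply: entails_hyp; left. Qed.

Lemma henkin_map A B : (forall G, deriv G A -> deriv G B) ->
  henkin A -> henkin B.
Proof. by move=> AB [n H]; exists n; apply: entails_map H. Qed.

Lemma henkin_map2 A B C : (forall G, deriv G A -> deriv G B -> deriv G C) ->
  henkin A -> henkin B -> henkin C.
Proof.
move=> ABC [m HA] [n HB]; exists (maxn m n); apply: (entails_map2 ABC).
- exact: entails_sub (stage_sub (leq_maxl _ _)) HA.
- exact: entails_sub (stage_sub (leq_maxr _ _)) HB.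
Qed.

Lemma henkin_Bot : ~ henkin Bot.
Proof. by move=> [n /stage_consistent]. Qed.

Lemma henkin_Neg A : henkin (Neg A) <-> ~ henkin A.
Proof.
split=> [HnA HA|HA].
  by apply: henkin_Bot; apply: henkin_map2 HnA HA => G; apply: deriv_impE.
(* [A] is decided at the stage given by its code: it is added there when consistent. *)
exists (pickle A); apply: entails_impI; apply: contrapT => conA; apply: HA.
exists (pickle A).+1; apply: entails_hyp => /=; rewrite pickleK.
by case: asboolP => // _; left.
Qed.

Lemma henkin_Imp A B : henkin (Imp A B) <-> (henkin A -> henkin B).
Proof.
split=> [HAB HA|H]; first by apply: henkin_map2 HAB HA => G; apply: deriv_impE.
have [/H HB|/henkin_Neg HA] := pselect (henkin A).
- apply: henkin_map HB => G HB; apply: deriv_impI.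
  by apply: (deriv_weaken HB) => C; right.
- apply: henkin_map HA => G HA; apply: deriv_impI; apply: deriv_exfalso.
  apply: (@deriv_impE _ _ A); last by apply: deriv_hyp; left.
  by apply: (deriv_weaken HA) => C; right.
Qed.

(** At its own stage [All B] is either added or refuted; in the latter case the negation of one
    instance is added, against the assumption on instances. *)
Lemma henkin_All B : henkin (All B) <-> forall t, henkin (inst t B).
Proof.
split=> [HB t|H]; first by apply: henkin_map HB => G; apply: deriv_allE.
have [n nE] : exists n, unpickle n = Some (All B).
  by exists (pickle (All B)); rewrite pickleK.
have [incB|conB] := pselect (entails (All B :: stage n) Bot).
- suff /henkin_Neg/(_ (H _)) :
    henkin (Neg (inst (Var (fresh (B :: stage n))) B)) by [].
  exists n.+1; apply: entails_hyp; rewrite /= nE.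
  by case: asboolP => // _; left.
- exists n.+1; apply: entails_hyp; rewrite /= nE.
  by case: asboolP => // _; left.
Qed.

(** A class modulo derivable equality is represented by its predicate, so extensionality turns
    derivable equations into equality of elements. *)
Definition eq_class (t : term) : {Q : term -> Prop |
    exists t, Q = fun u => henkin (Eq t u)} :=
  exist _ _ (ex_intro _ t erefl).

Lemma henkin_eqI t : henkin (Eq t t).
Proof. by exists 0, [::] => //; apply: deriv_eqI. Qed.

Lemma henkin_eq_sym t u : henkin (Eq t u) -> henkin (Eq u t).
Proof. by apply: henkin_map => G; apply: deriv_eq_sym. Qed.

Lemma henkin_rewrl (R : term -> term -> form Sigma) t t' u :
  (forall f a b, subst f (R a b) = R (tsubst f a) (tsubst f b)) ->
  henkin (Eq t t') -> henkin (R t u) -> henkin (R t' u).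
Proof.
by move=> RE; apply: henkin_map2 => G Ht; apply: deriv_rewr Ht (deriv_eqI _ _).
Qed.

Lemma henkin_rewrr (R : term -> term -> form Sigma) t u u' :
  (forall f a b, subst f (R a b) = R (tsubst f a) (tsubst f b)) ->
  henkin (Eq u u') -> henkin (R t u) -> henkin (R t u').
Proof.
move=> RE; apply: henkin_map2 => G Hu.
by apply: deriv_rewr (deriv_eqI _ _) Hu.
Qed.

Lemma eq_class_eq t u : eq_class t = eq_class u <-> henkin (Eq t u).
Proof.
split=> [/(congr1 (fun x => sval x u)) /= ->|tu]; first exact: henkin_eqI.
apply: eq_exist; apply: funext => s; apply: propext; split.
- exact: (henkin_rewrl (R := @Eq Sigma)).
- exact/(henkin_rewrl (R := @Eq Sigma))/henkin_eq_sym.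
Qed.

Definition term_model : structure Sigma := {|
  dom := {Q : term -> Prop | exists t, Q = fun u => henkin (Eq t u)};
  zero_of := eq_class Zero;
  max_of := eq_class Max;
  succ_of x y := exists t u,
    [/\ x = eq_class t, y = eq_class u & henkin (Succ t u)];
  path_of x y := exists t u,
    [/\ x = eq_class t, y = eq_class u & henkin (Path t u)];
  letter_of a x := exists2 t, x = eq_class t & henkin (Letter a t) |}.

Lemma eq_class_onto (x : term_model) : exists t, x = eq_class t.
Proof. by case: x => Q [t QE]; exists t; apply: eq_exist. Qed.

(** The truth lemma. It is stated for arbitrary assignments [f] of terms so that the induction
    passes under quantifiers, every element being the class of a term. *)
Lemma sat_term_model A : forall f,
  @sat Sigma term_model (fun i => eq_class (f i)) A <-> henkin (subst f A).
Proof.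
have E f t : @teval Sigma term_model (fun i => eq_class (f i)) t =
  eq_class (tsubst f t) by case: t.
have E2 (R : term -> term -> form Sigma) t u :
    (forall f a b, subst f (R a b) = R (tsubst f a) (tsubst f b)) ->
    (exists t' u', [/\ eq_class t = eq_class t', eq_class u = eq_class u' &
       henkin (R t' u')]) <-> henkin (R t u).
  move=> RE; split=> [[t' [u' [/eq_class_eq tt' /eq_class_eq uu' H]]]|H].
    apply: (henkin_rewrl RE (henkin_eq_sym tt')).
    exact: (henkin_rewrr RE (henkin_eq_sym uu')).
  by exists t, u.
elim: A => /= [|t u|t u|t u|a t|B IB C IC|B IB] f; rewrite ?E.
- by split=> // /henkin_Bot.
- exact: eq_class_eq.
- exact: E2.
- exact: E2.
- split=> [[t' /eq_class_eq tt' H]|]; last by exists (tsubst f t).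
  (* [Letter] is treated as a binary symbol that ignores its second argument, filled here by
     [Zero]. *)
  exact: (henkin_rewrl (R := fun t _ => Letter a t) (u := Zero) _
    (henkin_eq_sym tt')).
- by rewrite IB IC henkin_Imp.
- rewrite henkin_All -/(up f).
  have Ef t : scons (eq_class t : term_model) (fun i => eq_class (f i)) =
      fun i => eq_class (scons t f i) by apply: funext => -[].
  split=> [H t|H x]; first by rewrite inst_up -IB -Ef.
  by have [t ->] := eq_class_onto x; rewrite Ef IB -inst_up.
Qed.

Lemma models_term_model A : sentence A -> henkin A -> models term_model A.
Proof.
move=> A0 HA.
apply: (@models_sentence Sigma term_model (fun i => eq_class (Var i)) A A0).
by rewrite sat_term_model subst_Var.
Qed.

End Henkin.

Lemma completeness (Sigma : finType) (T : theory Sigma) psi :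
  (forall B, T B -> sentence B) -> sentence psi ->
  (forall M : structure Sigma, M -> (forall B, T B -> models M B) ->
     models M psi) ->
  provable T psi.
Proof.
move=> TS psi0 H; apply: contrapT => unprov.
have x0 : term_model T psi := eq_class T psi Zero.
have K : models (term_model T psi) psi.
  apply: (H _ x0) => B TB; apply: models_term_model;
    [exact: TS|exact: unprov|exact: TS|exact: henkin_theory].
have nK : models (term_model T psi) (Neg psi).
  apply: models_term_model; [exact: TS|exact: unprov| |exact: henkin_psi].
  by rewrite /sentence /= psi0.
exact: (nK (fun _ => x0) (K _)).
Qed.

(** The Henkin construction uses variables as constants, so the axioms have to be closed. Each
    member of the large conjunctions and disjunctions has at most the variable [#0] free, which A4
    binds. *)
Lemma sentence_A_word (Sigma : finType) : sentence (A_word Sigma).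
Proof.
have bigand a : fbound (\big[@And Sigma/Top]_(b : Sigma | b != a)
    Neg (Letter b (Var 0))) <= 1.
  apply: (big_ind (fun A : form Sigma => fbound A <= 1)) => // A B A1 B1.
  by rewrite /= !maxn0 geq_max A1.
suff : fbound (\big[@Or Sigma/Bot]_(a : Sigma) And (Letter a (Var 0))
    (\big[@And Sigma/Top]_(b : Sigma | b != a) Neg (Letter b (Var 0)))) <= 1.
  by rewrite /sentence /= !maxn0 => ?; lia.
apply: (big_ind (fun A : form Sigma => fbound A <= 1)) => [//|A B A1 B1|a _] /=.
  by rewrite maxn0 geq_max A1.
by have := bigand a; rewrite !maxn0 geq_max.
Qed.

Theorem theorem4p8 (Sigma : finType) :
  (forall psi : form Sigma, sentence psi ->
     (TC_valid (A_word Sigma) psi <->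
      (forall (n : nat) (w : n.+1.-tuple Sigma), models (word_model w) psi))) /\
  TC_complete (T1_Ind Sigma) (A_word Sigma).
Proof.
split=> [psi|psi psi0 /(TC_valid_words psi0) psiV]; first exact: TC_valid_words.
apply: completeness => // [B|M x0 MT].
- case=> [[->//|[Z [P ->]]]|->]; first exact: sentence_closure.
  exact: sentence_A_word.
have [n [w E]] := inductive_word_equivalent x0 (MT _ (or_intror erefl))
  (MT _ (or_introl (or_introl erefl)))
  (fun P => iffLR (models_closure _ _) (MT _ (or_introl (or_intror
     (ex_intro _ P (ex_intro _ P erefl)))))) psi0.
exact/E.
Qed.
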